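(* Let $\alpha\in(0,1]$, $C>0$, and let $X$ be a superreflexive Banach space with an equivalent norm $\|\cdot\|$ satisfying $$\lambda\|x\|^{1+\alpha}+(1-\lambda)\|y\|^{1+\alpha}-\|\lambda x+(1-\lambda)y\|^{1+\alpha}\le\lambda(1-\lambda)2^{-\alpha}C\|x-y\|^{1+\alpha}\quad\text{for all }x,y\in X,\ \lambda\in[0,1].$$ Let $\omega$ be a modulus of continuity such that $t\mapsto t^\alpha/\omega(t)$ is non-decreasing on $(0,\infty)$. Let $E\subset X$ be a nonempty subset and $f:E\to\mathbb{R}$, $G:E\to X^*$ two functions. There exists $F\in C^{1,\omega}(X)$ such that $(F,DF)=(f,G)$ on $E$ if and only if $(f,G)$ satisfies condition $(mg^{1,\omega})$ on $E$ for some $M>0$, that is, $$f(y)+\langle G(y),x-y\rangle+M\varphi(\|x-y\|)\ge f(z)+\langle G(z),x-z\rangle-M\varphi(\|x-z\|)\quad\text{for all }y,z\in E,\ x\in X.$$ Moreover, if $(f,G)$ satisfies $(mg^{1,\omega})$ with constant $M>0$, then $F$ can be chosen so that $M_\omega(DF)\le3\left(1+\frac{3^{1+\alpha}}{1+\alpha}C\right)M$.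
   Context: Spaces are real. A modulus of continuity here is a concave, increasing, continuous function $\omega:[0,\infty)\to[0,\infty)$ with $\omega(0)=0$ and $\lim_{t\to\infty}\omega(t)=\infty$; $\varphi(t)=\int_0^t\omega(s)\,ds$ for $t\ge0$. $\|\cdot\|_*$ is the norm of $X^*$ dual to $\|\cdot\|$, and $\langle\xi,v\rangle=\xi(v)$ for $\xi\in X^*$, $v\in X$. $C^{1,\omega}(X)$ is the set of Fréchet differentiable $g:X\to\mathbb{R}$ for which there is a constant $K>0$ with $\|Dg(x)-Dg(y)\|_*\le K\omega(\|x-y\|)$ for all $x,y\in X$, and $M_\omega(Dg)=\sup_{x\ne y}\frac{\|Dg(x)-Dg(y)\|_*}{\omega(\|x-y\|)}$. *)

(* Defs.v *)
From HB Require Import structures.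
From mathcomp Require Import all_boot all_order all_algebra.
From mathcomp Require Import all_classical all_reals all_analysis.

Set Implicit Arguments.
Unset Strict Implicit.
Unset Printing Implicit Defensive.

Import Order.TTheory GRing.Theory Num.Theory.
Import numFieldNormedType.Exports.

Local Open Scope classical_set_scope.
Local Open Scope ring_scope.

(* [N] is meant to be a norm on [X] defining its topology, and [xi] a continuous
   linear functional; the supremum is then finite and equals the dual norm.
   (The real [sup] of an unbounded set is 0.) *)
Definition dual_norm (R : realType) (X : lmodType R) (N : X -> R)
    (xi : X -> R) : R :=
  sup [set `|xi v| | v in [set v | N v <= 1]].

Section dual_space.
Context {R : realType} (X : normedModType R).

Definition cont_linear : {pred X -> R^o} :=
  mem [set xi : X -> R^o | linear xi /\ continuous xi].

Record cdual := CDual { cdual_val :> X -> R^o; cdualP : cdual_val \in cont_linear }.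

HB.instance Definition _ := [isSub of cdual for cdual_val].
HB.instance Definition _ := [Choice of cdual by <:].

Lemma cont_linear_submod_closed : submod_closed cont_linear.
Proof.
split=> [|a f g].
  rewrite inE; split=> [b u v|x]; last exact: cvg_cst.
  by rewrite /GRing.zero /= scaler0 addr0.
rewrite !inE => -[lf cf] [lg cg]; split=> [b u v|x].
  have -> (t : X) : (a *: f + g) t = a * f t + g t by [].
  rewrite lf lg /GRing.scale /=.
  by rewrite !mulrDr !mulrA [a * b]mulrC addrACA.
apply: (@cvgD _ R^o); last exact: cg.
by apply: (@cvgZr _ R^o); exact: cf.
Qed.

HB.instance Definition _ :=
  GRing.isSubmodClosed.Build R (X -> R^o) cont_linear cont_linear_submod_closed.
HB.instance Definition _ := [SubChoice_isSubLmodule of cdual by <:].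

Lemma cdual_linear (xi : cdual) : linear (xi : X -> R^o).
Proof. by have := cdualP xi; rewrite inE => -[]. Qed.

HB.instance Definition _ (xi : cdual) :=
  GRing.isLinear.Build R X R^o *:%R (cdual_val xi) (cdual_linear xi).

Lemma cdual_continuous (xi : cdual) : continuous (xi : X -> R^o).
Proof. by have := cdualP xi; rewrite inE => -[]. Qed.

Definition cdual_norm (xi : cdual) : R := dual_norm (@Num.norm R X) xi.

Lemma cdual_norm_has_sup (xi : cdual) :
  has_sup [set `|xi v| | v in [set v : X | `|v| <= 1]].
Proof.
split; first by exists `|xi 0|, 0 => //=; rewrite normr0.
have /linear_boundedP : bounded_near (xi : {linear X -> R^o}) (nbhs (0 : X)).
  exact/linear_bounded_continuous/cdual_continuous.
move=> /pinfty_ex_gt0[r r0 xir]; exists r => _ [v v1 <-].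
by rewrite (le_trans (xir v))// ler_piMr// ltW.
Qed.

Lemma cdual_norm_ub (xi : cdual) (v : X) : `|v| <= 1 -> `|xi v| <= cdual_norm xi.
Proof.
by move=> v1; apply: (ub_le_sup (cdual_norm_has_sup xi).2); exists v.
Qed.

Lemma cdual_norm_le (xi : cdual) (r : R) :
  (forall v : X, `|v| <= 1 -> `|xi v| <= r) -> cdual_norm xi <= r.
Proof.
move=> xir; apply: ge_sup; first by have [] := cdual_norm_has_sup xi.
by move=> _ [v /= /xir + <-].
Qed.

Lemma cdual_normD (xi eta : cdual) :
  cdual_norm (xi + eta) <= cdual_norm xi + cdual_norm eta.
Proof.
apply: cdual_norm_le => v v1.
by rewrite (le_trans (ler_normD _ _))// lerD// cdual_norm_ub.
Qed.

Lemma cdual_normZ_le (a : R) (xi : cdual) :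
  cdual_norm (a *: xi) <= `|a| * cdual_norm xi.
Proof.
by apply: cdual_norm_le => v v1; rewrite normrM ler_wpM2l// cdual_norm_ub.
Qed.

Lemma cdual_normZ (a : R) (xi : cdual) :
  cdual_norm (a *: xi) = `|a| * cdual_norm xi.
Proof.
have [->|a0] := eqVneq a 0.
  apply/eqP; rewrite eq_le cdual_normZ_le normr0 mul0r.
  by rewrite (le_trans (normr_ge0 ((0 *: xi) 0)))// cdual_norm_ub ?normr0.
apply/eqP; rewrite eq_le cdual_normZ_le /=.
rewrite -ler_pdivlMl ?normr_gt0// -normfV.
rewrite -{1}[xi]scale1r -(mulVf a0) -scalerA.
exact: cdual_normZ_le.
Qed.

Lemma cdual_norm0_eq0 (xi : cdual) : cdual_norm xi = 0 -> xi = 0.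
Proof.
move=> xi0; apply/val_inj/funext => v /=.
have [->|v0] := eqVneq v 0; first exact: (linear0 xi).
have nv : `|v| \is a GRing.unit by rewrite unitfE normr_eq0.
have : `|xi (`|v|^-1 *: v)| <= 0.
  by rewrite -xi0 cdual_norm_ub// normrZ normfV normr_id mulVr.
rewrite normr_le0 linearZ/= scaler_eq0 invr_eq0 normr_eq0 (negbTE v0) /=.
by move=> /eqP.
Qed.

HB.instance Definition _ :=
  Lmodule_isNormed.Build R cdual cdual_normD cdual_normZ cdual_norm0_eq0.

End dual_space.

(* The canonical embedding of [Y] into its bidual is onto. *)
Definition reflexive_space (R : realType) (Y : normedModType R) : Prop :=
  forall Phi : cdual (cdual Y), exists y : Y, forall xi : cdual Y, Phi xi = xi y.

(* The finite-dimensional subspace of [Y] is the span of the [b i]; the map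
   [\sum_i c i *: b i |-> \sum_i c i *: a i] is then a well-defined linear
   [T] on it with [l^-1 * `|y| <= `|T y| <= l * `|y|]. *)
Definition finitely_representable (R : realType) (Y X : normedModType R) : Prop :=
  forall (n : nat) (b : 'I_n -> Y) (l : R), 1 < l ->
  exists a : 'I_n -> X, forall c : 'I_n -> R,
    l^-1 * `|\sum_i c i *: b i| <= `|\sum_i c i *: a i| <= l * `|\sum_i c i *: b i|.

(* James' definition. *)
Definition superreflexive (R : realType) (X : normedModType R) : Prop :=
  forall Y : completeNormedModType R,
    finitely_representable Y X -> reflexive_space Y.

Record equivalent_norm (R : realType) (X : normedModType R) (N : X -> R) : Prop := {
  equivalent_normD : forall x y, N (x + y) <= N x + N y;
  equivalent_normZ : forall (a : R) x, N (a *: x) = `|a| * N x;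
  equivalent_norm0_eq0 : forall x, N x = 0 -> x = 0;
  equivalent_norm_bounds : exists c d : R,
    [/\ 0 < c, 0 < d & forall x, c * `|x| <= N x <= d * `|x|] }.

(* Only the values on [0, +oo[ matter; [w] is concave when [- w] is convex. *)
Record modulus_of_continuity (R : realType) (w : R -> R) : Prop := {
  modulus_ge0 : forall t, 0 <= t -> 0 <= w t;
  modulus_concave : convex_function (E := R^o) `[0, +oo[ (\- w);
  modulus_increasing : {in `[0, +oo[ &, {homo w : s t / s < t}};
  modulus_continuous : {within `[0, +oo[, continuous w};
  modulus0 : w 0 = 0;
  modulus_cvg_pinfty : w t @[t --> +oo] --> +oo }.

Definition primitive (R : realType) (w : R -> R) (t : R) : R :=
  (\int[lebesgue_measure]_(s in `[0, t]) w s)%R.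

Section C1omega.
Context {R : realType} {X : normedModType R} (N : X -> R) (w : R -> R).

Definition C1omega (g : X -> R) : Prop :=
  (forall x, differentiable g x) /\
  exists2 K : R, 0 < K &
    forall x y, dual_norm N ('d g x \- 'd g y) <= K * w (N (x - y)).

(* M_w(Dg); the supremum over an empty set (when X = 0) is -oo. *)
Definition deriv_seminorm (g : X -> R) : \bar R :=
  ereal_sup [set (dual_norm N ('d g (p.1) \- 'd g (p.2)) / w (N (p.1 - p.2)))%:E
            | p in [set p : X * X | p.1 != p.2]].

(* (F, DF) = (f, G) on [E]; [f] and [G] are total, but only used on [E]. *)
Definition extends_jet (E : set X) (f : X -> R) (G : X -> cdual X) (F : X -> R)
    : Prop :=
  forall x, E x -> F x = f x /\ ('d F x : X -> R) = G x.

(* Condition (mg^{1,w}) on [E] with constant [M]. *)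
Definition mg (E : set X) (f : X -> R) (G : X -> cdual X) (M : R) : Prop :=
  forall y z x, E y -> E z ->
    f z + G z (x - z) - M * primitive w (N (x - z))
      <= f y + G y (x - y) + M * primitive w (N (x - y)).

End C1omega.

(* Main.v *)
From HB Require Import structures.
Require Import Defs.
From mathcomp Require Import all_boot all_order all_algebra.
From mathcomp Require Import all_classical all_reals all_analysis.
From mathcomp Require Import ring lra.
Import Order.TTheory GRing.Theory Num.Theory.
Import numFieldNormedType.Exports.
Local Open Scope classical_set_scope.
Local Open Scope ring_scope.

Set Implicit Arguments.
Unset Strict Implicit.
Unset Printing Implicit Defensive.

(** Write phi for [primitive w] and theta(v) = N v * w (N v).

    Necessity is Taylor's formula.  By the mean value theorem a C^{1,w} function
    differs from its tangent at y by at most K theta(x - y)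
    ([C1omega_taylor]), and t w(t) <= (1 + alpha) phi(t)
    ([modulus_le_primitive]); so F is squeezed between the paraboloids of
    condition (mg) with M = K (1 + alpha).

    Sufficiency rests on one notion: a function is e-semiconcave
    (e-semiconvex) when its Jensen gap
      l u(x) + (1 - l) u(y) - u(l x + (1 - l) y)
    is at most l (1 - l) e(x - y) (at least the opposite).

    - The smoothness inequality on N makes phi o N semiconcave for a multiple of
      theta ([semiconcave_primitive_norm]).  The reason is that, t^alpha / w
      being nondecreasing, phi(t) is a concave function of t^(1 + alpha), so that
      the inequality on N^(1 + alpha) transfers to phi o N through the tangent
      inequality [primitive_tangent], as long as the intermediate point is not
      much smaller than x - y; otherwise a crude bound of the increments of phi
      suffices.

    - Hence the upper paraboloids f(y) + G(y)(x - y) + M phi(N(x - y)) are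
      e-semiconcave and the lower ones e-semiconvex, with e = A theta, and (mg)
      says that each lower one is below each upper one.  The largest
      e-semiconvex function F below all the upper ones is then also
      e-semiconcave ([semiconcave_insertion]): a convex combination of
      translates of F, lowered by the allowed gap, is again a competitor.

    - A function with both properties has an affine approximation with error e
      at each point ([tangent_of_semiconvex_semiconcave]).  It follows that F is
      differentiable, and comparing the approximations at two points gives
      4 A w for the modulus of continuity of its derivative
      ([gradient_modulus]).  On E the paraboloids touch, so F takes there the
      value f and the derivative G. *)

(** * Moduli of continuity and their primitives *)

Lemma powR_continuous_itv (R : realType) (p b : R) : 0 < p -> 0 < b ->
  {within `[0, b], continuous (@powR R ^~ p)}.
Proof.
move=> p0 b0; have dp (x : R) : 0 < x -> {for x, continuous (@powR R ^~ p)}.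
  move=> x0; apply: differentiable_continuous.
  by apply/derivable1_diffP; have [] := is_derive1_powR p x0.
apply/(continuous_within_itvP _ b0); split.
- by move=> x; rewrite in_itv/= => /andP[x0 _]; exact: dp.
- by rewrite powR0 ?gt_eqF//; exact: powR_cvg0.
- by apply: cvg_at_left_filter; exact: dp.
Qed.

Section modulus.
Context {R : realType} (w : R -> R).
Hypothesis wm : modulus_of_continuity w.

Lemma modulus_le s t : 0 <= s -> s <= t -> w s <= w t.
Proof.
move=> s0; rewrite le_eqVlt => /predU1P[->//|st].
apply/ltW/(modulus_increasing wm) => //; rewrite in_itv/= andbT//.
by rewrite (le_trans s0)// ltW.
Qed.

Lemma modulus_gt0 t : 0 < t -> 0 < w t.
Proof.
move=> t0; rewrite -(modulus0 wm); apply: (modulus_increasing wm) => //.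
  by rewrite in_itv/= lexx.
by rewrite in_itv/= ltW.
Qed.

Lemma modulus_continuous_itv b : {within `[0, b], continuous w}.
Proof.
apply: continuous_subspaceW (modulus_continuous wm).
by apply: subset_itvl; rewrite bnd_simp.
Qed.

Lemma modulus_integrable b :
  lebesgue_measure.-integrable `[0, b] (EFin \o w).
Proof.
apply: continuous_compact_integrable; first exact: segment_compact.
exact: modulus_continuous_itv.
Qed.

Lemma primitive0 : primitive w 0 = 0.
Proof. by rewrite /primitive set_itv1 Rintegral_set1. Qed.

Lemma primitive_continuous b : 0 <= b ->
  {within `[0, b], continuous primitive w}.
Proof.
by move=> b0; apply: parameterized_integral_continuous b0 (modulus_integrable b).
Qed.

Lemma is_derive_primitive (t : R) : 0 < t -> is_derive t 1 (primitive w) (w t).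
Proof.
move=> t0; have tt : t < t + 1 by rewrite ltrDl.
have wt : {for t, continuous w}.
  have := @modulus_continuous_itv (t + 1).
  move=> /continuous_within_itvP[]; first by rewrite (lt_trans t0).
  by move=> + _ _; apply; rewrite in_itv/= t0.
have [d <-] := continuous_FTC1_closed tt (modulus_integrable _) t0 wt.
by rewrite derive1E; exact/derivableP.
Qed.

Lemma primitive_increment (a b : R) : 0 <= a -> a <= b ->
  0 <= primitive w b - primitive w a <= w b * (b - a).
Proof.
move=> a0 ab; have b0 := le_trans a0 ab.
have [c] : exists2 c, c \in `[a, b] &
    primitive w b - primitive w a = w c * (b - a).
  apply: MVT_segment => // [x|].
    by rewrite in_itv/= => /andP[ax _]; apply/is_derive_primitive/(le_lt_trans a0).
  apply: continuous_subspaceW (primitive_continuous b0).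
  by apply: subset_itvr; rewrite bnd_simp.
rewrite in_itv/= => /andP[ac cb] ->; have c0 := le_trans a0 ac.
by rewrite mulr_ge0 ?subr_ge0//= ?ler_wpM2r ?subr_ge0// ?(modulus_le c0)// (modulus_ge0 wm).
Qed.

Lemma primitive_le_modulus t : 0 <= t -> primitive w t <= t * w t.
Proof.
by move=> t0; have /andP[_] := primitive_increment (lexx 0) t0;
  rewrite primitive0 !subr0 mulrC.
Qed.

Lemma primitive_le (a b : R) : 0 <= a -> a <= b -> primitive w a <= primitive w b.
Proof. by move=> a0 ab; rewrite -subr_ge0; have /andP[] := primitive_increment a0 ab. Qed.

Context (alpha : R).
Hypothesis alpha01 : 0 < alpha <= 1.
Hypothesis walpha :
  {in `]0, +oo[ &, {homo (fun t => t `^ alpha / w t) : s t / s <= t}}.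

Lemma modulus_ratio (s t : R) : 0 < s -> s <= t -> w t * s `^ alpha <= w s * t `^ alpha.
Proof.
move=> s0 st; have t0 := lt_le_trans s0 st.
have := walpha _ _ st; rewrite !in_itv/= !andbT => /(_ s0 t0).
rewrite ler_pdivrMr ?modulus_gt0// mulrAC ler_pdivlMr ?modulus_gt0//.
by rewrite mulrC [leRHS]mulrC.
Qed.

(** The slope of phi(t) as a function of t^(1 + alpha) is
    w(t) / ((1 + alpha) t^alpha), which is nonincreasing; so phi lies below its
    tangent in that variable. *)
Lemma primitive_tangent (a c : R) : 0 <= a -> 0 < c ->
  primitive w a - primitive w c <=
    w c / ((1 + alpha) * c `^ alpha) * (a `^ (1 + alpha) - c `^ (1 + alpha)).
Proof.
move=> a0 c0; have /andP[al0 al1] := alpha01.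
have p0 : 0 < 1 + alpha by rewrite addr_gt0.
have ca0 : 0 < c `^ alpha by exact: powR_gt0.
set k := w c / _.
have k0 : 0 <= k by rewrite divr_ge0 ?mulr_ge0 ?(modulus_ge0 wm) ?ltW.
(* The difference [h] increases up to [c] and decreases afterwards. *)
pose h t := primitive w t - k * t `^ (1 + alpha).
have hd (t : R) : 0 < t -> is_derive t 1 h (w t - k * (1 + alpha) * t `^ alpha).
  move=> t0; have := is_derive_primitive t0.
  have := is_derive1_powR (1 + alpha) t0; rewrite [X in t `^ X]addrC addKr => d1 d2.
  rewrite /h; apply: is_deriveB.
  rewrite -mulrA -/(_ *: _); exact: is_deriveZ.
have kE (t : R) : k * (1 + alpha) * t `^ alpha = w c * t `^ alpha / c `^ alpha.
  by rewrite /k invfM; field; rewrite !gt_eqF.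
have hc (b : R) : 0 < b -> {within `[0, b], continuous h}.
  move=> b0 x; apply: continuousB; first exact: (primitive_continuous (ltW b0)).
  apply: continuousM; first exact: cvg_cst.
  exact: powR_continuous_itv.
suff : h a <= h c by rewrite /h mulrBr; lra.
have [ac|ca] := leP a c.
  apply: (@ger0_derive1_le_cc _ h 0 c) => //.
  - by move=> x; rewrite in_itv/= => /andP[x0 _]; have [] := hd _ x0.
  - move=> x; rewrite in_itv/= => /andP[x0 xc]; rewrite derive1E.
    have [_ ->] := hd _ x0.
    by rewrite kE subr_ge0 ler_pdivrMr// modulus_ratio// ltW.
  - exact: hc.
  - by rewrite in_itv/= a0.
  - by rewrite in_itv/= lexx ltW.
apply: (@ler0_derive1_le_cc _ h c a) => //.
- move=> x; rewrite in_itv/= => /andP[cx _].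
  by have [] := hd _ (lt_trans c0 cx).
- move=> x; rewrite in_itv/= => /andP[cx xa]; rewrite derive1E.
  have [_ ->] := hd _ (lt_trans c0 cx).
  by rewrite kE subr_le0 ler_pdivlMr// modulus_ratio// ltW.
- apply: continuous_subspaceW (hc _ (lt_trans c0 ca)).
  by apply: subset_itvr; rewrite bnd_simp ltW.
- by rewrite in_itv/= lexx ltW.
- by rewrite in_itv/= lexx ltW.
- exact: ltW.
Qed.

(** This is the tangent inequality read at the end point 0. *)
Lemma modulus_le_primitive t : 0 <= t -> t * w t <= (1 + alpha) * primitive w t.
Proof.
rewrite le_eqVlt => /predU1P[<-|t0]; first by rewrite mul0r primitive0 mulr0.
have /andP[al0 _] := alpha01.
have p0 : 0 < 1 + alpha by rewrite addr_gt0.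
have := primitive_tangent (lexx 0) t0.
rewrite primitive0 !sub0r powR0 ?gt_eqF// sub0r mulrN lerN2.
rewrite powRD ?gt_eqF ?implybT// powRr1 ?(ltW t0)//.
have ta0 : 0 < t `^ alpha by exact: powR_gt0.
suff -> : w t / ((1 + alpha) * t `^ alpha) * (t * t `^ alpha) =
    t * w t / (1 + alpha) by rewrite ler_pdivrMr// [leRHS]mulrC.
by field; rewrite !gt_eqF.
Qed.

End modulus.

Lemma modulus_small (R : realType) (w : R -> R) (eps : R) :
  modulus_of_continuity w -> 0 < eps ->
  exists2 delta : R, 0 < delta & forall t, 0 <= t <= delta -> w t <= eps.
Proof.
move=> wm eps0.
have /(continuous_within_itvP _ ltr01)[_ + _] := @modulus_continuous_itv _ w wm 1.
rewrite (modulus0 wm) => w_cvg0; near (0 : R)^'+ => delta.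
have delta0 : 0 < delta by near: delta; exact: nbhs_right_gt.
exists delta => // t /andP[t0 td]; apply: le_trans (modulus_le wm t0 td) _.
apply: le_trans (ler_norm _) _.
by near: delta; exact: (cvgr0_norm_le _ w_cvg0).
Unshelve. all: by end_near. Qed.

(** * Semiconcave and semiconvex functions *)

Section semiconcavity.
Context {R : realType} {X : lmodType R}.
Implicit Types (e u : X -> R) (x y v : X) (l : R).

Definition jensen_gap u x y l : R :=
  l * u x + (1 - l) * u y - u (l *: x + (1 - l) *: y).

Definition semiconcave e u := forall x y l, 0 <= l <= 1 ->
  jensen_gap u x y l <= l * (1 - l) * e (x - y).

Definition semiconvex e u := forall x y l, 0 <= l <= 1 ->
  - (l * (1 - l) * e (x - y)) <= jensen_gap u x y l.

(** F is the largest e-semiconvex minorant of the upper family; it dominates the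
    lower family, whose members compete, and its semiconcavity comes from
    maximality. *)
Lemma semiconcave_insertion (T : Type) (I : set T) e (lo up : T -> X -> R) :
  I !=set0 ->
  (forall i, I i -> semiconvex e (lo i)) ->
  (forall i, I i -> semiconcave e (up i)) ->
  (forall i j x, I i -> I j -> lo i x <= up j x) ->
  exists F : X -> R,
    [/\ semiconvex e F, semiconcave e F &
        forall i x, I i -> lo i x <= F x <= up i x].
Proof.
move=> [i0 Ii0] lo_cvx up_ccv lo_up.
pose S := [set u : X -> R | semiconvex e u /\ forall i x, I i -> u x <= up i x].
pose Sx x := [set u x | u in S].
have Slo i : I i -> S (lo i) by move=> Ii; split=> [|j x]; [exact: lo_cvx|exact: lo_up].
have Sub i x : I i -> ubound (Sx x) (up i x).
  by move=> Ii _ [u [_ uup] <-]; exact: uup.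
have Shas x : has_sup (Sx x).
  by split; [exists (lo i0 x), (lo i0) => //; exact: Slo|exists (up i0 x); exact: Sub].
pose F x := sup (Sx x).
have leF u x : S u -> u x <= F x.
  by move=> Su; apply: (ub_le_sup (Shas x).2); exists u.
have Fle x b : (forall u, S u -> u x <= b) -> F x <= b.
  move=> ub; apply: ge_sup; first by have [] := Shas x.
  by move=> _ [u Su <-]; exact: ub.
have F_cvx : semiconvex e F.
  move=> x y l l01; have /andP[l0 l1] := l01.
  rewrite /jensen_gap lerBrDl lerBlDr; apply: Fle => u Su.
  have := Su.1 x y l l01; rewrite /jensen_gap.
  have := ler_wpM2l l0 (leF u x Su).
  have l1' : 0 <= 1 - l by rewrite subr_ge0.
  have := ler_wpM2l l1' (leF u y Su).
  lra.
exists F; split=> // [x y l l01|i x Ii]; last first.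
  by rewrite leF ?Fle// => [u [_]|]; [exact|exact: Slo].
have /andP[l0 l1] := l01; have l1' : 0 <= 1 - l by rewrite subr_ge0.
(* With [v = x - y] and [l] fixed, [U] is again e-semiconvex and, the upper
   functions being e-semiconcave, it is below all of them; so [U <= F], which at
   the intermediate point of [x] and [y] is the semiconcavity of [F]. *)
pose v := x - y.
pose U z := l * F (z + (1 - l) *: v) + (1 - l) * F (z - l *: v) - l * (1 - l) * e v.
suff /(leF U (l *: x + (1 - l) *: y)) : S U.
  have xE : l *: x + (1 - l) *: y + (1 - l) *: v = x.
    by rewrite -addrA -scalerDr /v subrKC -scalerDl subrKC scale1r.
  have yE : l *: x + (1 - l) *: y - l *: v = y.
    by rewrite addrAC -scalerBr /v subKr -scalerDl subrKC scale1r.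
  by rewrite /U xE yE /jensen_gap; lra.
split=> [a b k k01|i z Ii].
  have sh w : k *: a + (1 - k) *: b + w = k *: (a + w) + (1 - k) *: (b + w).
    by rewrite !scalerDr addrACA -scalerDl subrKC scale1r.
  have dsh w : a + w - (b + w) = a - b by rewrite opprD addrACA subrr addr0.
  have := ler_wpM2l l0 (F_cvx (a + (1 - l) *: v) (b + (1 - l) *: v) k k01).
  have := ler_wpM2l l1' (F_cvx (a - l *: v) (b - l *: v) k k01).
  by rewrite /jensen_gap /U !sh !dsh; lra.
have Fup w : F w <= up i w by apply: Fle => u [_]; exact.
have zE (p : X) : l *: (z + (1 - l) *: p) + (1 - l) *: (z - l *: p) = z.
  rewrite !scalerDr addrACA -scalerDl subrKC scale1r scalerN !scalerA.
  by rewrite [(1 - l) * l]mulrC subrr addr0.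
have vE : z + (1 - l) *: v - (z - l *: v) = v.
  by rewrite opprB addrC addrA subrK -scalerDl subrKC scale1r.
have := up_ccv i Ii (z + (1 - l) *: v) (z - l *: v) l l01.
rewrite /jensen_gap zE vE.
have := ler_wpM2l l0 (Fup (z + (1 - l) *: v)).
have := ler_wpM2l l1' (Fup (z - l *: v)).
by rewrite /U; lra.
Qed.

End semiconcavity.

(** * Semiconcavity of the primitive of the modulus along a smooth norm *)

Lemma jensen_gap_affine (R : realType) (X : lmodType R) (g : {linear X -> R^o})
    (psi : X -> R) (c k : R) (z x y : X) (l : R) :
  jensen_gap (fun x => c + g (x - z) + k * psi (x - z)) x y l =
  k * jensen_gap psi (x - z) (y - z) l.
Proof.
have zE : l *: x + (1 - l) *: y - z = l *: (x - z) + (1 - l) *: (y - z).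
  by rewrite !scalerBr addrACA -opprD -scalerDl subrKC scale1r.
have gE a b : g (l *: a + (1 - l) *: b) = l * g a + (1 - l) * g b.
  by rewrite linearD !linearZ.
rewrite /jensen_gap zE gE; ring.
Qed.

Section equivalent_norm_theory.
Context {R : realType} {X : normedModType R} (N : X -> R).
Hypothesis Nn : equivalent_norm N.

Lemma equivalent_norm0 : N 0 = 0.
Proof. by rewrite -[0 in LHS](scale0r 0) (equivalent_normZ Nn) normr0 mul0r. Qed.

Lemma equivalent_normN x : N (- x) = N x.
Proof. by rewrite -scaleN1r (equivalent_normZ Nn) normrN1 mul1r. Qed.

Lemma equivalent_norm_ge0 x : 0 <= N x.
Proof.
have [c [d [c0 _ /(_ x)/andP[+ _]]]] := equivalent_norm_bounds Nn.
by apply: le_trans; rewrite mulr_ge0// ltW.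
Qed.

Lemma equivalent_norm_gt0 x : x != 0 -> 0 < N x.
Proof.
move=> x0; rewrite lt0r equivalent_norm_ge0 andbT.
by apply: contra_neq x0; exact: (equivalent_norm0_eq0 Nn).
Qed.

Section smooth_norm.
Context (alpha C : R) (w : R -> R).
Hypothesis alpha01 : 0 < alpha <= 1.
Hypothesis C0 : 0 < C.
Hypothesis NC : forall (x y : X) (l : R), 0 <= l <= 1 ->
  l * N x `^ (1 + alpha) + (1 - l) * N y `^ (1 + alpha)
    - N (l *: x + (1 - l) *: y) `^ (1 + alpha)
  <= l * (1 - l) * 2 `^ (- alpha) * C * N (x - y) `^ (1 + alpha).
Hypothesis wm : modulus_of_continuity w.
Hypothesis walpha :
  {in `]0, +oo[ &, {homo (fun t => t `^ alpha / w t) : s t / s <= t}}.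

Let alpha_gt0 : 0 < alpha. Proof. by case/andP: alpha01. Qed.
Let p0 : 0 < 1 + alpha. Proof. by rewrite addr_gt0. Qed.

(** The smoothness inequality at the midpoint of [x] and [- x].  This lower bound
    on C is what lets the additive constants of the estimates below be absorbed
    in a multiple of C. *)
Lemma smoothness_constant_ge2 (x : X) : x != 0 -> 2 <= C.
Proof.
move=> x0; have Nx0 := equivalent_norm_gt0 x0.
have h01 : 0 <= (2^-1 : R) <= 1 by lra.
have := NC x (- x) h01.
rewrite (_ : 1 - 2^-1 = 2^-1 :> R); last by field.
rewrite scalerN subrr equivalent_norm0 powR0 ?gt_eqF// subr0 equivalent_normN.
have -> : x - - x = (2 : R) *: x by rewrite opprK scaler_nat.
rewrite (equivalent_normZ Nn) ger0_norm// powRM// ?equivalent_norm_ge0//.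
have Np : 0 < N x `^ (1 + alpha) by exact: powR_gt0.
have t0 : 0 < 2 `^ alpha :> R by exact: powR_gt0.
rewrite powRN [2 `^ (1 + alpha)]powRD ?gt_eqF ?implybT// powRr1//.
have -> : 2^-1 * 2^-1 * (2 `^ alpha)^-1 * C * (2 * 2 `^ alpha * N x `^ (1 + alpha))
  = C / 2 * N x `^ (1 + alpha) by field; rewrite gt_eqF.
have -> : 2^-1 * N x `^ (1 + alpha) + 2^-1 * N x `^ (1 + alpha) = N x `^ (1 + alpha) by field.
by rewrite ler_pMl// ler_pdivlMr// mul1r.
Qed.

(** The last step of the construction loses a factor 4, whence the 3 / 4 in
    front.  What matters is that the value is at least C / (1 + alpha) and, in a
    nonzero space, at least 3. *)
Definition smooth_constant : R := 3 / 4 * (1 + 3 `^ (1 + alpha) / (1 + alpha) * C).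

Lemma smooth_constant_ge0 : 0 <= smooth_constant.
Proof.
have : 0 <= 3 `^ (1 + alpha) / (1 + alpha) * C.
  by rewrite mulr_ge0 ?(ltW C0)// divr_ge0 ?powR_ge0// ltW.
by rewrite /smooth_constant; lra.
Qed.

Let three_powR : 3 <= 3 `^ (1 + alpha) :> R.
Proof. by rewrite le1r_powR// ?ler1n// lerDl ltW. Qed.

Let C_le_smooth_constant : C / (1 + alpha) <= smooth_constant.
Proof.
have : 3 * (C / (1 + alpha)) <= 3 `^ (1 + alpha) * (C / (1 + alpha)).
  by rewrite ler_wpM2r// ltW// divr_gt0.
have : 0 <= C / (1 + alpha) by rewrite ltW// divr_gt0.
by rewrite /smooth_constant [_ / _ * C]mulrAC -[_ * C / _]mulrA; lra.
Qed.

Let three_le_smooth_constant : 2 <= C -> 3 <= smooth_constant.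
Proof.
move=> C2; have : 3 * (C / (1 + alpha)) <= 3 `^ (1 + alpha) * (C / (1 + alpha)).
  by rewrite ler_wpM2r// ltW// divr_gt0.
have : 1 <= C / (1 + alpha).
  by rewrite ler_pdivlMr// mul1r; have /andP[_] := alpha01; lra.
by rewrite /smooth_constant [_ / _ * C]mulrAC -[_ * C / _]mulrA; lra.
Qed.

(** Let m be the intermediate point and d the distance of x and y.  If
    [N m >= d / 2], the tangent inequality for phi at [N m] reduces the claim to
    the smoothness inequality, with factor w(N m) / (N m)^alpha, which is
    controlled by its value at d / 2.  If [N m < d / 2], then x and y have norm at
    most 3 d / 2, and the increments of phi from [N m] are bounded by
    w(3 d / 2) <= 3 / 2 w(d) times their length. *)
Lemma semiconcave_primitive_norm :
  semiconcave (fun v => smooth_constant * (N v * w (N v)))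
    (fun x => primitive w (N x)).
Proof.
move=> x y l l01; have /andP[l0 l1] := l01.
have l1' : 0 <= 1 - l by rewrite subr_ge0.
have [->|xy] := eqVneq x y.
  rewrite subrr equivalent_norm0 mul0r !mulr0 /jensen_gap.
  have ->: l *: y + (1 - l) *: y = y by rewrite -scalerDl subrKC scale1r.
  lra.
have v0 : x - y != 0 by rewrite subr_eq0.
have C2 := smoothness_constant_ge2 v0.
set m := l *: x + (1 - l) *: y; set d := N (x - y).
have d0 : 0 < d by exact: equivalent_norm_gt0.
have ll : 0 <= l * (1 - l) by rewrite mulr_ge0.
have dw0 : 0 < d * w d by rewrite mulr_gt0// (modulus_gt0 wm).
have [mx my] : N x <= N m + (1 - l) * d /\ N y <= N m + l * d.
  have -> : (1 - l) * d = N ((1 - l) *: (x - y)).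
    by rewrite (equivalent_normZ Nn) ger0_norm.
  have -> : l * d = N (- (l *: (x - y))).
    by rewrite equivalent_normN (equivalent_normZ Nn) ger0_norm.
  have xE : x = m + (1 - l) *: (x - y).
    by rewrite /m -addrA -scalerDr subrKC -scalerDl subrKC scale1r.
  have yE : y = m - l *: (x - y).
    by rewrite /m addrAC -scalerBr subKr -scalerDl subrKC scale1r.
  by split; [rewrite {1}xE|rewrite {1}yE]; exact: (equivalent_normD Nn).
have [dm|md] := leP (d / 2) (N m).
  have m0 : 0 < N m by apply: lt_le_trans dm; rewrite divr_gt0.
  have tx := primitive_tangent wm alpha01 walpha (equivalent_norm_ge0 x) m0.
  have ty := primitive_tangent wm alpha01 walpha (equivalent_norm_ge0 y) m0.
  have ma0 : 0 < N m `^ alpha by exact: powR_gt0.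
  set k := w (N m) / _ in tx ty.
  have k0 : 0 <= k by rewrite divr_ge0 ?mulr_ge0 ?(modulus_ge0 wm) ?ltW.
  apply: (@le_trans _ _ (k * (l * (1 - l) * 2 `^ (- alpha) * C * d `^ (1 + alpha)))).
    have := ler_wpM2l k0 (NC x y l01); rewrite -/m -/d.
    have := ler_wpM2l l0 tx; have := ler_wpM2l l1' ty.
    by rewrite /jensen_gap -/m; lra.
  have da0 : 0 < d `^ alpha by exact: powR_gt0.
  have t0 : 0 < 2 `^ alpha :> R by exact: powR_gt0.
  have kd : k * (2 `^ (- alpha) * d `^ (1 + alpha)) <= (1 + alpha)^-1 * (d * w d).
    have d20 : 0 < d / 2 by rewrite divr_gt0.
    have wd : w (d / 2) <= w d by apply: (modulus_le wm); lra.
    have := le_trans (modulus_ratio wm walpha d20 dm) (ler_wpM2r (ltW ma0) wd).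
    rewrite powRM ?(ltW d0)// -powR_inv1// -powRrM mulN1r.
    rewrite powRD ?gt_eqF ?implybT// powRr1 ?(ltW d0)//.
    move=> h2.
    have -> : k * (2 `^ (- alpha) * (d * d `^ alpha)) =
        (1 + alpha)^-1 * (d * (w (N m) * (d `^ alpha * 2 `^ (- alpha)) / N m `^ alpha)).
      by rewrite /k; field; rewrite !gt_eqF.
    rewrite ler_wpM2l ?invr_ge0 ?(ltW p0)// ler_wpM2l ?(ltW d0)//.
    by rewrite ler_pdivrMr.
  have := ler_wpM2r (ltW dw0) C_le_smooth_constant.
  have := ler_wpM2l (ltW C0) kd => h1 h2.
  apply: (@le_trans _ _ (l * (1 - l) * (C * ((1 + alpha)^-1 * (d * w d))))).
    apply: le_trans (ler_wpM2l ll h1); rewrite le_eqVlt; apply/orP; left; apply/eqP; ring.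
  by rewrite ler_wpM2l// [leLHS]mulrA.
(* From here on, [N m < d / 2]. *)
have wd32 : w (3 / 2 * d) <= 3 / 2 * w d.
  have dd : d <= 3 / 2 * d by lra.
  have := modulus_ratio wm walpha d0 dd.
  have da0 : 0 < d `^ alpha by exact: powR_gt0.
  rewrite powRM ?(ltW d0)// mulrA ler_pM2r// => /le_trans; apply.
  rewrite mulrC ler_wpM2r// ?(modulus_ge0 wm) ?(ltW d0)//.
  by rewrite ler1_powR//; [lra|case/andP: alpha01].
have grow a b : 0 <= a -> 0 <= b <= 1 -> a <= N m + b * d ->
    primitive w a - primitive w (N m) <= 3 / 2 * w d * (b * d).
  move=> a0 /andP[b0 b1] ab.
  have bd0 : 0 <= b * d by rewrite mulr_ge0// ltW.
  have bd1 : b * d <= d by rewrite ler_piMl// ltW.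
  have wd0 := modulus_gt0 wm d0.
  have [am|ma] := leP a (N m).
    have := primitive_le wm a0 am => h; apply: (@le_trans _ _ 0); first by lra.
    by rewrite mulr_ge0// mulr_ge0// ltW.
  have /andP[_ /le_trans] := primitive_increment wm (equivalent_norm_ge0 m) (ltW ma).
  apply; apply: ler_pM.
  - exact: (modulus_ge0 wm).
  - by rewrite subr_ge0 ltW.
  - by apply: le_trans wd32; apply: (modulus_le wm) => //; lra.
  - by lra.
have gx := grow _ _ (equivalent_norm_ge0 x) (_ : 0 <= 1 - l <= 1) mx.
have gy := grow _ _ (equivalent_norm_ge0 y) l01 my.
have {}gx := gx ltac:(lra).
have := ler_wpM2l l0 gx; have := ler_wpM2l l1' gy.
have := ler_wpM2l ll (ler_wpM2r (ltW dw0) (three_le_smooth_constant C2)).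
by rewrite /jensen_gap -/m; lra.
Qed.

End smooth_norm.
End equivalent_norm_theory.

(** * Differentiability of functions that are both semiconvex and semiconcave *)

Section differentiability.
Context {R : realType} {X : normedModType R}.
Implicit Types (F e : X -> R) (x v : X).

(** Error functions e(v) = o(|v|); an upper bound is enough, since the functions
    of interest are nonnegative. *)
Definition superlinear e :=
  forall eps : R, 0 < eps -> \forall v \near (0 : X), e v <= eps * `|v|.

Lemma superlinear_ray e v (eps : R) : superlinear e -> 0 < eps ->
  \forall t \near 0^'+, e (t *: v) <= eps * t.
Proof.
move=> se eps0; have v1 : 0 < 1 + `|v| by rewrite ltr_wpDr.
have e'0 : 0 < eps / (1 + `|v|) by rewrite divr_gt0.
have tv : t *: v @[t --> 0^'+] --> (0 : X).
  rewrite -(scale0r v); apply: cvgZl; apply: cvg_at_right_filter; exact: cvg_id.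
near=> t; have t0 : 0 < t by near: t; exact: nbhs_right_gt.
have : e (t *: v) <= eps / (1 + `|v|) * `|t *: v|.
  by near: t; exact: (tv _ (se _ e'0)).
move=> /le_trans; apply; rewrite normrZ gtr0_norm// [t * _]mulrC mulrA.
rewrite ler_pM2r// mulrAC ler_pdivrMr// ler_pM2l//.
by rewrite lerDr.
Unshelve. all: by end_near. Qed.

Lemma le_near0_eq0 (c : R) :
  (forall eps : R, 0 < eps -> \forall t \near 0^'+, t * `|c| <= eps * t) ->
  c = 0.
Proof.
move=> h; apply/eqP; rewrite -normr_le0; apply/ler_addgt0Pl => eps eps0.
rewrite addr0; near (0 : R)^'+ => t.
have t0 : 0 < t by near: t; exact: nbhs_right_gt.
rewrite -(ler_pM2l t0) [t * eps]mulrC.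
by near: t; exact: h.
Unshelve. all: by end_near. Qed.

(** Along a ray, the two inequalities make the difference quotient q(t) differ
    from q(s) by at most e(s v) / s for t in ]0, s]; this pins its limit at 0, and the distance from
    the quotient to its limit.  The same inequalities at midpoints make the limit
    additive in v. *)
Lemma tangent_of_semiconvex_semiconcave F e x : (forall v, 0 <= e v) ->
  superlinear e -> semiconvex e F -> semiconcave e F ->
  exists L : {linear X -> R^o}, forall v, `|F (x + v) - F x - L v| <= e v.
Proof.
move=> e0 se Fcvx Fccv.
have Fgap a b l : 0 <= l <= 1 -> `|jensen_gap F a b l| <= l * (1 - l) * e (a - b).
  by move=> l01; rewrite ler_norml Fcvx ?Fccv.
pose q v t := (F (x + t *: v) - F x) / t.
have q_cauchy v s t : 0 < t -> t <= s -> `|q v t - q v s| <= e (s *: v) / s.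
  move=> t0 ts; have s0 := lt_le_trans t0 ts.
  have l01 : 0 <= t / s <= 1 by rewrite divr_ge0 ?(ltW t0) ?(ltW s0)//= ler_pdivrMr// mul1r.
  have := Fgap (x + s *: v) x _ l01; rewrite /jensen_gap.
  have -> : (t / s) *: (x + s *: v) + (1 - t / s) *: x = x + t *: v.
    by rewrite scalerDr addrAC -scalerDl subrKC scale1r scalerA divfK ?gt_eqF.
  rewrite [x + s *: v - x]addrC addKr.
  have -> : t / s * F (x + s *: v) + (1 - t / s) * F x - F (x + t *: v) =
     t * (q v s - q v t) by rewrite /q; field; rewrite !gt_eqF.
  rewrite normrM gtr0_norm// distrC -ler_pdivlMl// => /le_trans; apply.
  have -> : t^-1 * (t / s * (1 - t / s) * e (s *: v)) = (1 - t / s) * (e (s *: v) / s).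
    by field; rewrite !gt_eqF.
  by rewrite ler_piMl ?divr_ge0 ?(ltW s0)// gerBl; case/andP: l01.
have q_sep v s t : 0 < s -> 0 < t ->
    q v s - e (s *: v) / s <= q v t + e (t *: v) / t.
  move=> s0 t0.
  have es : 0 <= e (s *: v) / s by rewrite divr_ge0// ltW.
  have et : 0 <= e (t *: v) / t by rewrite divr_ge0// ltW.
  have [st|/ltW ts] := leP s t.
    by have := q_cauchy v _ _ s0 st; rewrite ler_norml => /andP[]; lra.
  by have := q_cauchy v _ _ t0 ts; rewrite ler_norml => /andP[]; lra.
(* The lower bounds q(t) - e(t v) / t and the upper bounds q(t) + e(t v) / t are
   separated, so that their common cut can serve as the limit of q. *)
pose low v := [set q v t - e (t *: v) / t | t in [set t | 0 < t]].
have low_sup v : has_sup (low v).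
  split; first by exists (q v 1 - e (1 *: v) / 1), 1 => //=.
  by exists (q v 1 + e (1 *: v) / 1) => _ [t /= t0 <-]; exact: q_sep.
pose L v : R^o := sup (low v).
have L_ray v t : 0 < t -> `|F (x + t *: v) - F x - t * L v| <= e (t *: v).
  move=> t0.
  have -> : F (x + t *: v) - F x - t * L v = t * (q v t - L v).
    by rewrite /q; field; rewrite gt_eqF.
  rewrite normrM gtr0_norm// mulrC -ler_pdivlMr// ler_norml.
  have lo : q v t - e (t *: v) / t <= L v.
    by apply: (ub_le_sup (low_sup v).2); exists t.
  have up : L v <= q v t + e (t *: v) / t.
    apply: ge_sup; first by have [] := low_sup v.
    by move=> _ [s /= s0 <-]; exact: q_sep.
  by apply/andP; split; lra.
have L0 : L 0 = 0.
  apply: le_near0_eq0 => eps eps0; near=> t.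
  have t0 : 0 < t by near: t; exact: nbhs_right_gt.
  have := L_ray 0 t t0; rewrite scaler0 addr0 subrr sub0r normrN normrM gtr0_norm//.
  move=> /le_trans; apply; rewrite -(scaler0 _ t).
  by near: t; exact: superlinear_ray.
have LZ_gt0 a v : 0 < a -> L (a *: v) = a * L v.
  move=> a0; apply/eqP; rewrite -subr_eq0; apply/eqP.
  apply: le_near0_eq0 => eps eps0; near=> t.
  have t0 : 0 < t by near: t; exact: nbhs_right_gt.
  have := L_ray (a *: v) t t0; have := L_ray v (t * a) (mulr_gt0 t0 a0).
  rewrite scalerA => h1 h2.
  have h3 : e ((t * a) *: v) <= eps / 2 * t.
    rewrite -scalerA; near: t; apply: superlinear_ray => //.
    by rewrite divr_gt0.
  rewrite -[X in X * _](gtr0_norm t0) -normrM ler_norml.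
  move: h1 h2; rewrite !ler_norml => /andP[h1 h1'] /andP[h2 h2'].
  by apply/andP; split; lra.
have LD u v : L (u + v) = L u + L v.
  apply/eqP; rewrite -subr_eq0; apply/eqP.
  apply: le_near0_eq0 => eps eps0.
  have eps4 : 0 < eps / 4 by rewrite divr_gt0.
  near=> t; have t0 : 0 < t by near: t; exact: nbhs_right_gt.
  have h01 : 0 <= (2^-1 : R) <= 1 by lra.
  (* x + t (u + v) is the midpoint of x + 2 t u and x + 2 t v. *)
  have := Fgap (x + t *: (2 *: u)) (x + t *: (2 *: v)) _ h01.
  have e1 : e (t *: (2 *: u)) <= eps / 4 * t.
    by near: t; exact: superlinear_ray.
  have e2 : e (t *: (2 *: v)) <= eps / 4 * t by near: t; exact: superlinear_ray.
  have e3 : e (t *: (u + v)) <= eps / 4 * t by near: t; exact: superlinear_ray.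
  have e4 : e (t *: (2 *: (u - v))) <= eps / 4 * t.
    by near: t; exact: superlinear_ray.
  have := L_ray (2 *: u) t t0; have := L_ray (2 *: v) t t0.
  have := L_ray (u + v) t t0; rewrite !LZ_gt0//.
  rewrite /jensen_gap opprD addrACA subrr add0r -scalerBr -scalerBr.
  have -> : 2^-1 *: (x + t *: (2 *: u)) + (1 - 2^-1) *: (x + t *: (2 *: v)) =
      x + t *: (u + v).
    have half a : 2^-1 *: (x + t *: (2 *: a)) = 2^-1 *: x + t *: a.
      by rewrite scalerDr !scalerA; congr (_ + _ *: _); field.
    rewrite (_ : 1 - 2^-1 = 2^-1 :> R); last by field.
    rewrite !half addrACA -scalerDl -scalerDr (_ : 2^-1 + 2^-1 = 1 :> R).
      by rewrite scale1r.
    by field.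
  move=> h1 h2 h3 h4; rewrite -[X in X * _](gtr0_norm t0) -normrM.
  move: h1 h2 h3 h4; rewrite !ler_norml.
  move=> /andP[? ?] /andP[? ?] /andP[? ?] /andP[? ?].
  by apply/andP; split; lra.
have LN v : L (- v) = - L v.
  by apply/eqP; rewrite -subr_eq0 opprK -LD addNr L0.
have L_linear : linear L.
  move=> a u v; rewrite LD; congr (_ + _).
  have [a0|a0|->] := ltgtP a 0.
  - rewrite -[a in LHS]opprK scaleNr LN LZ_gt0 ?oppr_gt0//.
    by rewrite mulNr opprK.
  - exact: LZ_gt0.
  - by rewrite !scale0r L0.
pose lin := GRing.isLinear.Build R X R^o *:%R L L_linear.
exists (HB.pack L lin : {linear X -> R^o}) => v /=.
by have := L_ray v 1 ltr01; rewrite scale1r mul1r.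
Unshelve. all: by end_near. Qed.

Lemma differentiable_remainder F e x (L : {linear X -> R^o}) : superlinear e ->
  continuous L -> (forall v, `|F (x + v) - F x - L v| <= e v) ->
  differentiable F x /\ ('d F x : X -> R) = L.
Proof.
move=> se Lc FL.
have FE : (F : X -> R^o) \o shift x = cst (F x : R^o) + L +o_ (0 : X) id.
  apply/eqaddoP => eps eps0; near=> v.
  apply: (@le_trans _ _ (e v)); last by near: v; exact: se.
  by have := FL v; rewrite /= [x + v]addrC opprD addrA.
have dE := diff_unique Lc FE.
split=> //; apply/diff_locallyP; rewrite dE; split => //.
Unshelve. all: by end_near. Qed.

End differentiability.

Lemma linear_continuous_upper_bound (R : realType) (X : normedModType R)
    (L : {linear X -> R^o}) (B : R) :
  (forall v, `|v| <= 1 -> L v <= B) -> continuous L.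
Proof.
move=> LB; apply/linear_bounded_continuous/ex_bound; exists B.
apply/nbhs_norm0P; exists 1 => //= v /= /ltW v1.
rewrite ler_norml LB// andbT lerNl -linearN LB// normrN//.
Qed.

(** * Derivatives controlled by a modulus *)

Section regularity.
Context {R : realType} {X : normedModType R} (N : X -> R) (w : R -> R).
Hypothesis Nn : equivalent_norm N.
Hypothesis wm : modulus_of_continuity w.

(** N is comparable to the norm of X, and w tends to 0 at 0. *)
Lemma superlinear_modulus (A : R) : 0 <= A ->
  superlinear (fun v => A * (N v * w (N v))).
Proof.
move=> A0 eps eps0.
have [c [d [c0 d0 Nb]]] := equivalent_norm_bounds Nn.
have Ad : 0 < A * d + 1 by rewrite ltr_wpDl// mulr_ge0// ltW.
have [delta delta0 wd] := modulus_small wm (divr_gt0 eps0 Ad).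
apply/nbhs_norm0P; exists (delta / d); first by rewrite /= divr_gt0.
move=> v /=; rewrite ltr_pdivlMr// => vd; have /andP[_ Nd] := Nb v.
have N0 := equivalent_norm_ge0 Nn v.
have wN : w (N v) <= eps / (A * d + 1).
  by apply: wd; rewrite N0/= (le_trans Nd)// mulrC ltW.
have w0 : 0 <= w (N v) := modulus_ge0 wm N0.
apply: (@le_trans _ _ (A * (d * `|v| * (eps / (A * d + 1))))).
  by rewrite ler_wpM2l// ler_pM.
have -> : A * (d * `|v| * (eps / (A * d + 1))) = (A * d / (A * d + 1)) * (eps * `|v|).
  by field; rewrite gt_eqF.
rewrite ler_piMl ?mulr_ge0 ?(ltW eps0)// ler_pdivrMr// mul1r; lra.
Qed.

(** Let p be the midpoint of x and y, and h a vector with [N h <= N (x - y) / 2].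
    The points p + h and p - h are within [N (x - y)] of both x and y.  The
    alternating sum of the four Taylor estimates at these points cancels all the
    values of [F] and leaves twice the difference of the gradients at h. *)
Lemma gradient_modulus (F : X -> R) (L : X -> {linear X -> R^o}) (A : R) :
  0 <= A -> (forall x v, `|F (x + v) - F x - L x v| <= A * (N v * w (N v))) ->
  forall x y v, N v <= 1 -> `|L x v - L y v| <= 4 * A * w (N (x - y)).
Proof.
move=> A0 FL.
have main x y v : N v <= 1 -> L x v - L y v <= 4 * A * w (N (x - y)).
  move=> v1; have [->|xy] := eqVneq x y.
    by rewrite !subrr (equivalent_norm0 Nn) (modulus0 wm) mulr0.
  set d := N (x - y).
  have d0 : 0 < d by apply: (equivalent_norm_gt0 Nn); rewrite subr_eq0.
  (* In terms of k, the midpoint is both x - k and y + k. *)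
  pose h := (d / 2) *: v; pose k := 2^-1 *: (x - y).
  have Nh : N h <= d / 2.
    rewrite (equivalent_normZ Nn) ger0_norm ?divr_ge0 ?(ltW d0)//.
    by rewrite ler_piMr// divr_ge0 ?(ltW d0).
  have Nk : N k = d / 2.
    by rewrite (equivalent_normZ Nn) ger0_norm ?invr_ge0// mulrC.
  have rem u : N u <= d -> A * (N u * w (N u)) <= A * (d * w d).
    move=> ud; have u0 := equivalent_norm_ge0 Nn u.
    by rewrite ler_wpM2l// ler_pM// ?(modulus_ge0 wm)// (modulus_le wm).
  have NhkD : N (h + k) <= d by have := equivalent_normD Nn h k; lra.
  have NhkB : N (h - k) <= d.
    by have := equivalent_normD Nn h (- k); rewrite (equivalent_normN Nn); lra.
  have NhkDN : N (- h + k) <= d by rewrite addrC -opprB (equivalent_normN Nn).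
  have NhkBN : N (- h - k) <= d by rewrite -opprD (equivalent_normN Nn).
  have xE : x - k = y + k.
    apply/eqP; rewrite subr_eq -addrA /k -scalerDl.
    by rewrite (_ : 2^-1 + 2^-1 = 1 :> R) ?scale1r ?subrKC//; field.
  have := le_trans (FL x (h - k)) (rem _ NhkB).
  have := le_trans (FL y (h + k)) (rem _ NhkD).
  have := le_trans (FL x (- h - k)) (rem _ NhkBN).
  have := le_trans (FL y (- h + k)) (rem _ NhkDN).
  have -> : x + (h - k) = y + (h + k) by rewrite addrCA xE addrCA.
  have -> : x + (- h - k) = y + (- h + k) by rewrite addrCA xE addrCA.
  have LD z a b : L z (a + b) = L z a + L z b by rewrite linearD.
  have LN z a : L z (- a) = - L z a by rewrite linearN.
  rewrite !LD !LN !ler_norml.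
  have LhE z : L z h = d / 2 * L z v by rewrite /h linearZ.
  rewrite !LhE => /andP[a1 a2] /andP[b1 b2] /andP[c1 c2] /andP[e1 e2].
  have d2 : 0 < 2 * d by rewrite mulr_gt0.
  rewrite -(ler_pM2l d2); lra.
move=> x y v v1; rewrite ler_norml main// andbT lerNl opprB.
by rewrite -[x - y]opprB (equivalent_normN Nn) main.
Qed.

Lemma dual_norm_le (xi : X -> R) (r : R) :
  (forall v, N v <= 1 -> `|xi v| <= r) -> dual_norm N xi <= r.
Proof.
move=> xir; apply: ge_sup; last by move=> _ [v /= /xir + <-].
by exists `|xi 0|, 0 => //=; rewrite (equivalent_norm0 Nn).
Qed.

(** The supremum defining [dual_norm] is a true upper bound only for bounded
    functionals, whence the continuity assumptions. *)
Lemma le_dual_norm (L1 L2 : {linear X -> R^o}) v :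
  continuous L1 -> continuous L2 ->
  `|L1 v - L2 v| <= dual_norm N (L1 \- L2) * N v.
Proof.
move=> /linear_bounded_continuous/linear_boundedP/pinfty_ex_gt0[r1 r10 L1r].
move=> /linear_bounded_continuous/linear_boundedP/pinfty_ex_gt0[r2 r20 L2r].
have [c [d [c0 d0 Nb]]] := equivalent_norm_bounds Nn.
have [->|v0] := eqVneq v 0.
  by rewrite (linear0 L1) (linear0 L2) subrr normr0 (equivalent_norm0 Nn) mulr0.
have Nv := equivalent_norm_gt0 Nn v0.
rewrite -ler_pdivrMr//; apply: (@ub_le_sup R).
  exists ((r1 + r2) / c) => _ [u /= u1 <-].
  apply: le_trans (ler_normB _ _) _.
  apply: le_trans (lerD (L1r u) (L2r u)) _.
  rewrite -mulrDl ler_wpM2l ?addr_ge0 ?(ltW r10) ?(ltW r20)//.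
  by rewrite -(ler_pM2l c0) divff ?gt_eqF//; have /andP[/le_trans + _] := Nb u; apply.
exists ((N v)^-1 *: v) => /=.
  by rewrite (equivalent_normZ Nn) ger0_norm ?invr_ge0 ?(ltW Nv)// mulVf// gt_eqF.
have LZ (L : {linear X -> R^o}) a u : L (a *: u) = a * L u by rewrite linearZ.
by rewrite !LZ -mulrBr normrM ger0_norm ?invr_ge0 ?(ltW Nv)// mulrC.
Qed.

Lemma C1omega_taylor (F : X -> R) (K : R) : 0 < K ->
  (forall x, differentiable F x) ->
  (forall x y, dual_norm N ('d F x \- 'd F y) <= K * w (N (x - y))) ->
  forall x v, `|F (x + v) - F x - 'd F x v| <= K * (N v * w (N v)).
Proof.
move=> K0 dF dFK x v.
pose g (t : R) : R := F (x + t *: v).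
have gd (t : R) : is_derive t 1 g ('d F (x + t *: v) v).
  have dv := @diff_derivable _ _ _ _ _ v (dF (x + t *: v)).
  have E : (fun h : R => h^-1 *: (g (h *: 1 + t) - g t)) =
           (fun h : R => h^-1 *: (F (h *: v + (x + t *: v)) - F (x + t *: v))).
    apply/funext => h; rewrite /g [h *: 1]mulr1 scalerDl; congr (_ *: (F _ - _)).
    by rewrite addrCA.
  split; first by rewrite /derivable /= /comp /= E.
  by rewrite /derive /= /comp /= E -deriveE.
have gc : {within `[0, 1], continuous g}.
  by apply: derivable_within_continuous => t _; have [] := gd t.
have [c] := MVT ltr01 (fun t _ => gd t) gc.
rewrite in_itv/= => /andP[c0 c1]; rewrite /g scale1r scale0r addr0 subr0 mulr1 => ->.
have dc z : continuous ('d F z) by exact: diff_continuous.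
apply: le_trans (le_dual_norm v (dc _) (dc _)) _.
have N0 := equivalent_norm_ge0 Nn v.
have -> : K * (N v * w (N v)) = K * w (N v) * N v by ring.
rewrite ler_wpM2r//; apply: le_trans (dFK _ _) _.
rewrite addrC addKr (equivalent_normZ Nn) gtr0_norm//.
rewrite ler_wpM2l ?(ltW K0)//; apply: (modulus_le wm); first by rewrite mulr_ge0 ?(ltW c0).
by rewrite ler_piMl// ltW.
Qed.

End regularity.

(** * Jets and their extensions *)

Section extension.
Context {R : realType} {X : normedModType R} (N : X -> R) (w : R -> R).
Context (alpha : R).
Hypothesis Nn : equivalent_norm N.
Hypothesis wm : modulus_of_continuity w.
Hypothesis alpha01 : 0 < alpha <= 1.
Hypothesis walpha :
  {in `]0, +oo[ &, {homo (fun t => t `^ alpha / w t) : s t / s <= t}}.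

Lemma mg_of_extension (E : set X) (f : X -> R) (G : X -> cdual X) (F : X -> R) :
  C1omega N w F -> extends_jet E f G F ->
  exists2 M : R, 0 < M & mg N w E f G M.
Proof.
move=> [dF [K K0 dFK]] FfG; have /andP[al0 _] := alpha01.
exists (K * (1 + alpha)); first by rewrite mulr_gt0// addr_gt0.
have rem y x : E y ->
    `|F x - (f y + G y (x - y))| <= K * (1 + alpha) * primitive w (N (x - y)).
  move=> Ey; have [Fy dFy] := FfG y Ey.
  have := C1omega_taylor Nn wm K0 dF dFK y (x - y).
  rewrite subrKC Fy dFy opprD addrA => /le_trans; apply.
  rewrite -mulrA ler_wpM2l ?(ltW K0)//.
  exact: (modulus_le_primitive wm alpha01 walpha (equivalent_norm_ge0 Nn _)).
move=> y z x Ey Ez; have := rem y x Ey; have := rem z x Ez.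
by rewrite !ler_norml => /andP[? ?] /andP[? ?]; lra.
Qed.

Context (C : R).
Hypothesis C0 : 0 < C.
Hypothesis NC : forall (x y : X) (l : R), 0 <= l <= 1 ->
  l * N x `^ (1 + alpha) + (1 - l) * N y `^ (1 + alpha)
    - N (l *: x + (1 - l) *: y) `^ (1 + alpha)
  <= l * (1 - l) * 2 `^ (- alpha) * C * N (x - y) `^ (1 + alpha).

(** The function inserted between the paraboloids extends the jet: an upper and a
    lower paraboloid with the same vertex squeeze it to first order there. *)
Lemma extension_of_mg (E : set X) (f : X -> R) (G : X -> cdual X) (M : R) :
  E !=set0 -> 0 < M -> mg N w E f G M ->
  exists F : X -> R, [/\ forall x, differentiable F x, extends_jet E f G F &
    forall x y, dual_norm N ('d F x \- 'd F y) <=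
      4 * (M * smooth_constant alpha C) * w (N (x - y))].
Proof.
move=> E0 M0 fGM.
set A := M * smooth_constant alpha C.
have A0 : 0 <= A by rewrite mulr_ge0 ?(ltW M0)// (smooth_constant_ge0 alpha01 C0).
pose e (v : X) := A * (N v * w (N v)).
pose lo z x := f z + G z (x - z) + (- M) * primitive w (N (x - z)).
pose up y x := f y + G y (x - y) + M * primitive w (N (x - y)).
have phi_ccv := semiconcave_primitive_norm Nn alpha01 C0 NC wm walpha.
have shift (z x y : X) : x - z - (y - z) = x - y by rewrite opprB addrA subrK.
have up_ccv y : E y -> semiconcave e (up y).
  move=> _ a b l l01.
  rewrite (jensen_gap_affine (G y) (fun v => primitive w (N v))).
  have := ler_wpM2l (ltW M0) (phi_ccv (a - y) (b - y) l l01).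
  by rewrite shift /e /A; lra.
have lo_cvx z : E z -> semiconvex e (lo z).
  move=> _ a b l l01.
  rewrite (jensen_gap_affine (G z) (fun v => primitive w (N v))).
  have := ler_wpM2l (ltW M0) (phi_ccv (a - z) (b - z) l l01).
  by rewrite shift /e /A; lra.
have [F [F_cvx F_ccv F_lo_up]] := semiconcave_insertion E0 lo_cvx up_ccv
  (fun z y x Ez Ey => ltac:(rewrite /lo mulNr; exact: fGM)).
have N_ge0 := equivalent_norm_ge0 Nn.
have e_ge0 v : 0 <= e v by rewrite mulr_ge0// mulr_ge0// (modulus_ge0 wm).
have e_sup : superlinear e := superlinear_modulus Nn wm A0.
have dF x : differentiable F x /\ forall v, `|F (x + v) - F x - 'd F x v| <= e v.
  have [L FL] := tangent_of_semiconvex_semiconcave x e_ge0 e_sup F_cvx F_ccv.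
  suff /(differentiable_remainder e_sup)/(_ FL)[dFx dE] : continuous L.
    by split=> // v; rewrite dE.
  (* L is continuous because F is locally bounded above by a paraboloid. *)
  have [z Ez] := E0.
  have [c [d [c0 d0 Nb]]] := equivalent_norm_bounds Nn.
  pose B := f z + G z (x - z) + `|G z| + M * primitive w (N (x - z) + d)
    - F x + A * (d * w d).
  apply: (@linear_continuous_upper_bound _ _ _ B) => v v1.
  have Nv : N v <= d.
    by have /andP[_ /le_trans] := Nb v; apply; rewrite ler_piMr// ltW.
  have ev : e v <= A * (d * w d).
    by rewrite ler_wpM2l// ler_pM ?(modulus_ge0 wm)// (modulus_le wm).
  have phiv : primitive w (N (x + v - z)) <= primitive w (N (x - z) + d).
    apply: (primitive_le wm) => //; rewrite addrAC.
    by apply: le_trans (equivalent_normD Nn _ _) _; rewrite lerD2l.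
  have Gv : G z v <= `|G z| := le_trans (ler_norm _) (cdual_norm_ub (G z) v1).
  have := FL v; rewrite ler_norml => /andP[lo_v _].
  have /andP[_] := F_lo_up z (x + v) Ez.
  have GD : G z (x + v - z) = G z (x - z) + G z v by rewrite addrAC linearD.
  rewrite /up GD /B; have := ler_wpM2l (ltW M0) phiv; lra.
exists F; split=> [x|x Ex|x y].
- by have [] := dF x.
- have FxE : F x = f x.
    have := F_lo_up x x Ex; rewrite /lo /up subrr linear0 (equivalent_norm0 Nn).
    by rewrite primitive0 !mulr0 !addr0; case/andP=> ? ?; apply/eqP; rewrite eq_le; apply/andP.
  split=> //.
  have M_sup := superlinear_modulus Nn wm (ltW M0).
  have [] // := @differentiable_remainder _ _ F _ x (G x) M_sup (@cdual_continuous _ _ (G x)).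
  move=> v; have := F_lo_up x (x + v) Ex.
  rewrite /lo /up [x + v]addrC addrK FxE.
  have := ler_wpM2l (ltW M0) (primitive_le_modulus wm (N_ge0 v)).
  by move=> h /andP[? ?]; rewrite ler_norml; apply/andP; split; lra.
- apply: (dual_norm_le Nn) => v v1.
  exact: (gradient_modulus Nn wm A0 (fun x => (dF x).2)).
Qed.

End extension.

Theorem theorem1p9 (R : realType) (alpha C : R) (X : completeNormedModType R)
    (N : X -> R) (w : R -> R) (E : set X) (f : X -> R) (G : X -> cdual X) :
  0 < alpha <= 1 -> 0 < C ->
  superreflexive X ->
  equivalent_norm N ->
  (forall (x y : X) (l : R), 0 <= l <= 1 ->
     l * N x `^ (1 + alpha) + (1 - l) * N y `^ (1 + alpha)
       - N (l *: x + (1 - l) *: y) `^ (1 + alpha)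
     <= l * (1 - l) * 2 `^ (- alpha) * C * N (x - y) `^ (1 + alpha)) ->
  modulus_of_continuity w ->
  {in `]0, +oo[ &, {homo (fun t => t `^ alpha / w t) : s t / s <= t}} ->
  E !=set0 ->
  ((exists2 F : X -> R, C1omega N w F & extends_jet E f G F) <->
   (exists2 M : R, 0 < M & mg N w E f G M)) /\
  (forall M : R, 0 < M -> mg N w E f G M ->
     exists F : X -> R,
       [/\ C1omega N w F, extends_jet E f G F &
           (deriv_seminorm N w F
              <= (3 * (1 + 3 `^ (1 + alpha) / (1 + alpha) * C) * M)%:E)%E]).
Proof.
move=> alpha01 C0 _ Nn NC wm walpha E0.
have ext (M : R) : 0 < M -> mg N w E f G M -> exists F : X -> R,
    [/\ C1omega N w F, extends_jet E f G F & (deriv_seminorm N w F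
      <= (3 * (1 + 3 `^ (1 + alpha) / (1 + alpha) * C) * M)%:E)%E].
  move=> M0 fGM; set K := 3 * _ * M.
  have [F [dF FfG dFK]] := extension_of_mg Nn wm alpha01 walpha C0 NC E0 M0 fGM.
  have KE : 4 * (M * smooth_constant alpha C) = K.
    by rewrite /K /smooth_constant; field; have /andP[] := alpha01; lra.
  rewrite KE in dFK.
  have K0 : 0 < K.
    rewrite -KE mulr_gt0// mulr_gt0// /smooth_constant.
    have /andP[al0 _] := alpha01.
    have : 0 <= 3 `^ (1 + alpha) / (1 + alpha) * C.
      by rewrite mulr_ge0 ?(ltW C0)// divr_ge0 ?powR_ge0// addr_ge0// ltW.
    lra.
  exists F; split=> //; first by split=> //; exists K.
  apply: ub_ereal_sup => _ [[x y] /= xy <-]; rewrite lee_fin.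
  have dxy : 0 < N (x - y) by apply: (equivalent_norm_gt0 Nn); rewrite subr_eq0.
  by rewrite ler_pdivrMr ?(modulus_gt0 wm).
split=> //; split=> [[F]|[M M0 fGM]].
  exact: (mg_of_extension Nn wm alpha01 walpha).
by have [F [? ? _]] := ext M M0 fGM; exists F.
Qed.
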